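(* Let $(V,\|\cdot\|)$ be a Minkowski plane. Then the following are equivalent: (i) $(V,\|\cdot\|)$ is strictly convex and Radon; (ii) for all $x,y\in V$ with $x\neq y$, and for every pair of parallel lines $\ell_x\ni x$ and $\ell_y\ni y$ that support, at $x$ and at $y$ respectively, the circle with diameter $xy$, the bisector $B(x,y)$ is contained in the strip bounded by $\ell_x$ and $\ell_y$.
   Context: A Minkowski plane is a two-dimensional real vector space $V$ equipped with a norm $\|\cdot\|$. The bisector of $x,y\in V$ is $B(x,y)=\{z\in V:\|z-x\|=\|z-y\|\}$. The circle with diameter $xy$ is $\{z\in V:\|z-\tfrac12(x+y)\|=\tfrac12\|x-y\|\}$; a line supports this circle at a point $p$ of the circle if it passes through $p$ and does not meet the interior of the corresponding ball. The strip bounded by two distinct parallel lines is the closed convex hull of their union. The plane is strictly convex if $\|x+y\|<\|x\|+\|y\|$ for all linearly independent $x,y\in V$. For non-zero $x,y\in V$, $x$ is normal to $y$, written $x\dashv y$, if $\|x\|\le\|x+\lambda y\|$ for all $\lambda\in\mathbb{R}$. The norm (and the plane) is called Radon if normality is symmetric: $x\dashv y\iff y\dashv x$ for all non-zero $x,y\in V$. *)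

(* Defs.v *)
From HB Require Import structures.
From mathcomp Require Import all_boot all_order all_algebra.
From mathcomp Require Import all_classical all_reals all_analysis.

Set Implicit Arguments.
Unset Strict Implicit.
Unset Printing Implicit Defensive.

Import Order.TTheory GRing.Theory Num.Theory.
Import numFieldNormedType.Exports.

Local Open Scope classical_set_scope.
Local Open Scope ring_scope.

(* Finite-dimensional normed spaces: the join of the library's normed modules
   and finite-dimensional vector spaces, so that the norm, the norm topology
   and \dim are available on the same carrier. The norm is arbitrary. *)
#[short(type="normedVectType")]
HB.structure Definition NormedVector (K : numFieldType) :=
  {V of NormedModule K V & Vector K V}.

Section MinkowskiPlane.
Context {R : realType} {V : normedVectType R}.
Implicit Types (x y c p v : V) (r : R) (l : set V).

Definition bisector x y : set V := [set z | `|z - x| = `|z - y|].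

Definition circle c r : set V := [set z | `|z - c| = r].

Definition disc c r : set V := [set z | `|z - c| <= r].

Definition line p v : set V := [set p + t *: v | t in [set: R]].

Definition is_line l := exists p v, v != 0 /\ l = line p v.

(* Coinciding lines count as parallel; the supporting lines of one circle at
   two antipodal points never coincide, as their common line would pass through
   the centre. *)
Definition parallel l1 l2 :=
  exists p1 p2 v, [/\ v != 0, l1 = line p1 v & l2 = line p2 v].

Definition supports l c r p :=
  [/\ is_line l, circle c r p, l p & l `&` (disc c r)° = set0].

(* The circle with diameter xy is circle (midpoint x y) (half_dist x y). *)
Definition midpoint x y : V := 2^-1 *: (x + y).

Definition half_dist x y : R := 2^-1 * `|x - y|.

Definition closed_convex_hull (A : set V) : set V :=
  smallest [set B : set V | closed B /\ convex_set B] A.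

Definition strip l1 l2 : set V := closed_convex_hull (l1 `|` l2).

(* Only meaningful for non-zero x and y. *)
Definition normal x y := forall t : R, `|x| <= `|x + t *: y|.

End MinkowskiPlane.

Section PlaneProperties.
Context {R : realType} (V : normedVectType R).

Definition strictly_convex :=
  forall x y : V, free [:: x; y] -> `|x + y| < `|x| + `|y|.

Definition radon :=
  forall x y : V, x != 0 -> y != 0 -> (normal x y <-> normal y x).

End PlaneProperties.

(* Main.v *)
Require Import Defs.
From mathcomp Require Import all_boot all_order all_algebra.
From mathcomp Require Import all_classical all_reals all_analysis.
From mathcomp Require Import ring lra.
Import Order.TTheory GRing.Theory Num.Theory.
Import numFieldNormedType.Exports.
Import VectorInternalTheory.
Local Open Scope classical_set_scope.
Local Open Scope ring_scope.

(** Put the midpoint of x and y at the origin and write a for half of x - y.  A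
    line of direction v supports the circle at x exactly when a is normal to v,
    and the strip is then the set of the points s a + t v with |s| <= 1.  Hence
    the bisector condition becomes: whenever a is normal to v and
    |s a + t v - a| = |s a + t v + a|, one has |s| <= 1 (bisectors_in_slabs,
    bisector_in_strip_iff).

    If the norm is strictly convex and Radon, then v is normal to a, so
    g(r) = |t v + r a| has its minimum at r = 0, and by strict convexity it
    increases strictly for r > 0.  A bisector point gives g(s - 1) = g(s + 1),
    which is impossible when s > 1; the case s < -1 follows by symmetry.

    The converse rests on slabs_normal_shift0: if a is normal to v and some
    d = v + t a is normal to a, then t = 0.  Indeed every line T d + R a, for T
    arbitrarily large, meets the bisector at some T d + r a with |r| <= 1, by the
    intermediate value theorem.  The a-coordinate of that point is T t + r, and
    it stays in [-1, 1] only if t = 0.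
    - Radon: if a is normal to v, minimizing |v + t a| over t gives a vector
      v + t a normal to a; then t = 0 and v itself is normal to a.
    - Strict convexity: if |p + q| = |p| + |q| with p, q independent, the unit
      circle contains a segment, and two independent vectors are normal to its
      direction a.  Choose v such that a is normal to v; both vectors have
      multiples of the form v + t a, so both would be parallel to v. *)

(** * Vector identities *)

Section Coordinates.
Context {K : fieldType} {V : vectType K}.

Lemma v2rD : {morph @v2r K V : x y / x + y}. Proof. exact: linearD. Qed.
Lemma v2rN : {morph @v2r K V : x / - x}. Proof. exact: linearN. Qed.
Lemma v2rZ k : {morph @v2r K V : x / k *: x}. Proof. exact: linearZ. Qed.
Lemma v2r0 : v2r (0 : V) = 0. Proof. exact: linear0. Qed.

End Coordinates.

(** Decides identities between linear combinations by comparing coordinates;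
    what remains is that the denominators are non-zero. *)
Ltac vector_field :=
  apply/v2r_inj/rowP => ?; rewrite ?(v2rD, v2rN, v2rZ, v2r0) ?mxE; field.

(** * Normality *)

Section Normality.
Context {R : realType} {V : normedVectType R}.
Implicit Types (a c m p u v w x y z : V) (s t : R).

Lemma normal_scale k {a v} : normal a v -> normal (k *: a) v.
Proof.
move=> av t; have [->|k0] := eqVneq k 0; first by rewrite scale0r normr0.
have -> : k *: a + t *: v = k *: (a + (t / k) *: v) by vector_field.
by rewrite !normrZ ler_wpM2l.
Qed.

Lemma normal_shift t {a v} :
  normal a v -> `|a + t *: v| <= `|a| -> normal (a + t *: v) v.
Proof.
move=> av le_t s; rewrite -addrA -scalerDl.
exact: le_trans le_t (av _).
Qed.

(** Normality bounds the a-coordinate by the norm.  This makes the coordinate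
    well defined and continuous. *)
Lemma normal_coord_le {a v} s t :
  normal a v -> `|s| * `|a| <= `|s *: a + t *: v|.
Proof. by move=> /(normal_scale s)/(_ t); rewrite normrZ. Qed.

Lemma normal_coord0 {a v s t} :
  a != 0 -> normal a v -> s *: a + t *: v = 0 -> s = 0.
Proof.
move=> a0 /(normal_coord_le s t) + st0; rewrite st0 normr0.
by rewrite pmulr_lle0 ?normr_gt0// normr_le0 => /eqP.
Qed.

Lemma normal_free {a v} :
  a != 0 -> v != 0 -> normal a v -> free [:: a; v].
Proof.
move=> a0 v0 av; rewrite free_cons seq1_free v0 andbT span_seq1.
apply/vlineP => -[k ak]; have := av (- k).
by rewrite {2}ak scaleNr subrr normr0 normr_le0 (negPf a0).
Qed.

Lemma free2_span {x y} (dimV : \dim {: V} = 2%N) :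
  free [:: x; y] -> forall w, exists s t, w = s *: x + t *: y.
Proof.
move=> fxy w; have bxy : basis_of fullv [tuple x; y].
  by rewrite basisEfree fxy subvf dimV.
exists (coord [tuple x; y] ord0 w), (coord [tuple x; y] (lift ord0 ord0) w).
by rewrite {1}(coord_basis bxy (memvf w)) !big_ord_recl big_ord0 /= addr0.
Qed.

Lemma continuous_norm_line x v : continuous (fun t : R => `|x + t *: v|).
Proof.
move=> t; apply: cvg_norm; apply: cvgD; first exact: cvg_cst.
by apply: cvgZr_tmp; exact: cvg_id.
Qed.

(** The nearest point to the origin on the line x + R a: outside a bounded
    interval of parameters the norm exceeds its value at x, so the extreme value
    theorem applies. *)
Lemma normal_left_exists x {a} : a != 0 -> exists t, normal (x + t *: a) a.
Proof.
move=> a0; have a0' : 0 < `|a| by rewrite normr_gt0.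
(* |K a| = 2 |x|, so |x + t a| >= |x| as soon as |t| > K. *)
pose K := 2 * `|x| / `|a|.
have K0 : 0 <= K by rewrite divr_ge0 ?mulr_ge0.
have [||t _ tmin] := @EVT_min R (fun t => `|x + t *: a|) (- K) K.
- by lra.
- exact/continuous_subspaceT/continuous_norm_line.
exists t => s; rewrite -addrA -scalerDl.
have [sK|sK] := boolP (t + s \in `[- K, K]); first exact: tmin.
have t0 : `|x + t *: a| <= `|x|.
  by have := tmin 0; rewrite in_itv/= scale0r addr0; apply; lra.
apply: le_trans t0 _.
have {}sK : K < `|t + s|.
  by rewrite ltNge; apply: contra sK; rewrite in_itv/= ler_norml.
have : K * `|a| <= `|(t + s) *: a| by rewrite normrZ ler_wpM2r// ltW.
rewrite /K divfK ?gt_eqF// => le1.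
have := ler_normB (x + (t + s) *: a) x; rewrite addrAC subrr add0r.
lra.
Qed.

(** The one-step Hahn-Banach extension, for the functional r a |-> r |a|: some C
    satisfies r |a| - |r a - b| <= C <= |r a + b| - r |a| for all r, and sending b
    to C keeps the functional below the norm.  The kernel of the extension is
    then the required direction. *)
Lemma normal_right_exists {a} (dimV : \dim {: V} = 2%N) :
  a != 0 -> exists2 v, v != 0 & normal a v.
Proof.
move=> a0.
have [b ba] : exists b, b \notin <[a]>%VS.
  apply: contrapT => /forallNP all_a; have /dimvS : (fullv <= <[a]>)%VS.
    by apply/subvP => b _; apply/negPn/negP/all_a.
  by rewrite dimV dim_vline a0.
pose E := [set r * `|a| - `|r *: a - b| | r in [set: R]].
have E_ub r : ubound E (`|r *: a + b| - r * `|a|).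
  move=> _ [r' _ <-].
  have : `|(r' + r) *: a| <= `|r' *: a - b| + `|r *: a + b|.
    by apply: le_trans (ler_normD _ _); rewrite scalerDl addrACA addNr addr0.
  have := ler_norm (r' + r); rewrite normrZ.
  move=> /(ler_wpM2r (normr_ge0 a)); lra.
have E0 : E !=set0 by exists (0 * `|a| - `|0 *: a - b|), 0.
have E_sup : has_sup E by split=> //; exists (`|0 *: a + b| - 0 * `|a|).
pose C := sup E.
have ub r : r * `|a| + C <= `|r *: a + b|.
  by have := ge_sup E0 (E_ub r); rewrite -/C; lra.
have lb r : r * `|a| - C <= `|r *: a - b|.
  have : r * `|a| - `|r *: a - b| <= C.
    by apply: sup_upper_bound => //; exists r.
  lra.
have a0' : `|a| != 0 by rewrite normr_eq0.
exists (b - (C / `|a|) *: a).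
  apply: contra ba; rewrite subr_eq0 => /eqP ->.
  by apply/vlineP; exists (C / `|a|).
(* Dividing by |t| reduces the claim to lb for t < 0 and to ub for t > 0. *)
move=> t; have [t0|t0|->] := ltgtP t 0; last by rewrite scale0r addr0.
- have -> : a + t *: (b - (C / `|a|) *: a)
      = - t *: ((- t^-1 + C / `|a|) *: a - b) by vector_field; rewrite a0' lt_eqF.
  rewrite normrZ gtr0_norm ?oppr_gt0//.
  have := lb (- t^-1 + C / `|a|).
  rewrite -(ler_pM2l (_ : 0 < - t)) ?oppr_gt0//; apply: le_trans.
  suff -> : - t * ((- t^-1 + C / `|a|) * `|a| - C) = `|a| by [].
  by field; rewrite a0' lt_eqF.
- have -> : a + t *: (b - (C / `|a|) *: a)
      = t *: ((t^-1 - C / `|a|) *: a + b) by vector_field; rewrite a0' gt_eqF.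
  rewrite normrZ gtr0_norm//.
  have := ub (t^-1 - C / `|a|).
  rewrite -(ler_pM2l t0); apply: le_trans.
  suff -> : t * ((t^-1 - C / `|a|) * `|a| + C) = `|a| by [].
  by field; rewrite a0' gt_eqF.
Qed.

End Normality.

(** * Supporting lines and strips *)

Section Strips.
Context {R : realType} {V : normedVectType R}.
Implicit Types (a c m p u v w x y z : V) (s t : R).

Definition slab m a v : set V :=
  [set z | exists s t, `|s| <= 1 /\ z = m + (s *: a + t *: v)].

Lemma disc_interior c r : 0 < r -> (disc c r)° = ball c r.
Proof.
move=> r0; rewrite -interior_closed_ballE// closed_ballE//.
congr (_°); apply/seteqP.
by split=> z; rewrite /disc /closed_ball_ /= distrC.
Qed.

Lemma supports_line c p v : p != c -> v != 0 ->
  supports (line p v) c `|p - c| p <-> normal (p - c) v.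
Proof.
move=> pc v0; have r0 : 0 < `|p - c| by rewrite normr_gt0 subr_eq0.
split=> [[_ _ _ Hi] t|pcv].
  rewrite leNgt; apply/negP => lt_t.
  suff : (line p v `&` (disc c `|p - c|)°) (p + t *: v) by rewrite Hi.
  split; first by exists t.
  by rewrite disc_interior// -ball_normE /= distrC addrAC.
split=> //.
- by exists p, v.
- by exists 0; rewrite // scale0r addr0.
- rewrite disc_interior//; apply/seteqP; split=> // _ [[t _ <-]].
  by rewrite -ball_normE /= distrC addrAC ltNge pcv.
Qed.

Lemma line_through {p q v} : line p v q -> line p v = line q v.
Proof.
move=> [t _ <-]; apply/seteqP; split=> _ [s _ <-].
  by exists (s - t) => //; vector_field.
by exists (t + s) => //; vector_field.
Qed.

Lemma slab_coord {m a v} s t : a != 0 -> normal a v ->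
  slab m a v (m + (s *: a + t *: v)) -> `|s| <= 1.
Proof.
move=> a0 av [s' [t' [s'1 /addrI E]]].
suff /eqP : s - s' = 0 by rewrite subr_eq0 => /eqP ->.
apply: (normal_coord0 a0 av (t := t - t')).
by rewrite -(subrr (s' *: a + t' *: v)) -{1}E; vector_field.
Qed.

(** A point of a-coordinate s with |s| > 1 is at distance at least
    (|s| - 1) |a| from the slab, by normal_coord_le. *)
Lemma closed_slab {m a v} (dimV : \dim {: V} = 2%N) :
  a != 0 -> v != 0 -> normal a v -> closed (slab m a v).
Proof.
move=> a0 v0 av; have avE := free2_span dimV (normal_free a0 v0 av).
rewrite -openC openE => z /= zS; apply/nbhs_ballP.
have [s [t zE]] := avE (z - m).
have s1 : 1 < `|s|.
  rewrite ltNge; apply/negP => s1; apply: zS; exists s, t.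
  by split=> //; rewrite -zE addrC subrK.
exists ((`|s| - 1) * `|a|); first by rewrite /= mulr_gt0 ?subr_gt0 ?normr_gt0.
move=> w; rewrite -ball_normE /= => zw [s' [t' [s'1 wE]]].
have := normal_coord_le (s - s') (t - t') av.
have -> : (s - s') *: a + (t - t') *: v = z - w.
  have -> : z = m + (z - m) by rewrite addrC subrK.
  by rewrite wE zE; vector_field.
move=> /le_lt_trans/(_ zw); rewrite ltr_pM2r ?normr_gt0//.
by have := ler_normD (s - s') s'; rewrite subrK; lra.
Qed.

Lemma conv_sumE (k : {i01 R}) x y :
  conv k (x : convex_lmodType V) y = k%:num *: x + (1 - k%:num) *: y.
Proof. by []. Qed.

Lemma convex_slab m a v : convex_set (slab m a v).
Proof.
move=> _ _ k /set_mem[s [t [s1 ->]]] /set_mem[s' [t' [s'1 ->]]].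
apply/mem_set.
exists (k%:num * s + (1 - k%:num) * s'), (k%:num * t + (1 - k%:num) * t').
have k0 : 0 <= k%:num by []. have k1 : k%:num <= 1 by [].
split; last by rewrite conv_sumE; vector_field.
rewrite -[leRHS](subrKC k%:num); apply: le_trans (ler_normD _ _) _.
have k1' : 0 <= 1 - k%:num by rewrite subr_ge0.
rewrite !normrM (ger0_norm k0) (ger0_norm k1').
by apply: lerD; rewrite ler_piMr.
Qed.

Lemma strip_lines {m a v} (dimV : \dim {: V} = 2%N) :
  a != 0 -> v != 0 -> normal a v ->
  strip (line (m + a) v) (line (m - a) v) = slab m a v.
Proof.
move=> a0 v0 av; apply/seteqP; split.
  apply: smallest_sub; first by split; [exact: closed_slab|exact: convex_slab].
  move=> _ [[t _ <-]|[t _ <-]].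
    by exists 1, t; rewrite normr1; split=> //; vector_field.
  by exists (-1), t; rewrite normrN1; split=> //; vector_field.
move=> _ [s [t [s1 ->]]] B [[_ cvxB] subB].
have [k0 k1] : 0 <= (1 + s) / 2 /\ (1 + s) / 2 <= 1.
  by move: s1; rewrite ler_norml; split; lra.
(* These weights on the lines at m + a and m - a give the a-coordinate s. *)
have := cvxB (m + a + t *: v) (m - a + t *: v) (Itv01 k0 k1).
have -> : m + a + t *: v \in B by apply/mem_set/subB; left; exists t.
have -> : m - a + t *: v \in B by apply/mem_set/subB; right; exists t.
move=> /(_ isT isT)/set_mem; congr B.
by rewrite conv_sumE /=; vector_field.
Qed.

End Strips.

(** * Bisectors and the geometry of the norm *)

Section MainArgument.
Context {R : realType} {V : normedVectType R}.
Context (dimV : \dim {: V} = 2%N).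
Implicit Types (a c m p u v w x y z : V) (s t : R).

(** The bisector condition for the pair a, -a, written in the coordinates along a
    and along the direction v of the supporting lines. *)
Definition bisectors_in_slabs := forall a v, a != 0 -> v != 0 -> normal a v ->
  forall s t, `|s *: a + t *: v - a| = `|s *: a + t *: v + a| -> `|s| <= 1.

Lemma bisector_in_strip_iff :
  (forall x y, x != y -> forall lx ly : set V, parallel lx ly ->
     supports lx (midpoint x y) (half_dist x y) x ->
     supports ly (midpoint x y) (half_dist x y) y ->
     bisector x y `<=` strip lx ly) <-> bisectors_in_slabs.
Proof.
have radius_x x y : half_dist x y = `|x - midpoint x y|.
  have -> : x - midpoint x y = 2^-1 *: (x - y) by rewrite /midpoint; vector_field.
  by rewrite normrZ ger0_norm.
have radius_y x y : half_dist x y = `|y - midpoint x y|.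
  have -> : y - midpoint x y = 2^-1 *: (y - x) by rewrite /midpoint; vector_field.
  by rewrite normrZ ger0_norm// distrC.
split=> [H a v a0 v0 av s t st|H x y xy _ _ [p1 [p2 [v [v0 -> ->]]]] sx sy].
  have mid0 : midpoint a (- a) = 0 by rewrite /midpoint subrr scaler0.
  have a0N : a != - a.
    apply: contra a0 => /eqP aN; have : 2 *: a == 0.
      by rewrite scaler_nat mulr2n {2}aN subrr.
    by rewrite scaler_eq0 pnatr_eq0.
  have := H a (- a) a0N (line a v) (line (- a) v).
  rewrite {1}radius_x radius_y mid0.
  rewrite !supports_line ?oppr_eq0// !subr0 => /(_ _ av)H1.
  have : strip (line (0 + a) v) (line (0 - a) v) (0 + (s *: a + t *: v)).
    rewrite !add0r; apply: H1; first by exists a, (- a), v.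
      by rewrite -scaleN1r; exact: normal_scale.
    by rewrite /bisector /= opprK.
  by rewrite (strip_lines dimV)//; exact: slab_coord.
set m := midpoint x y; pose a := 2^-1 *: (x - y).
have xE : x = m + a by rewrite /m /midpoint /a; vector_field.
have yE : y = m - a by rewrite /m /midpoint /a; vector_field.
have a0 : a != 0 by rewrite scaler_eq0 subr_eq0 (negPf xy) orbF invr_eq0 pnatr_eq0.
have [_ _ /line_through lx _] := sx; have [_ _ /line_through ly _] := sy.
have av : normal a v.
  move: sx; rewrite lx radius_x supports_line// -/m ?xE.
    by rewrite addrAC subrr add0r.
  by rewrite -subr_eq0 addrAC subrr add0r.
rewrite lx ly xE yE (strip_lines dimV)// => z zB.
have [s [t zE]] := free2_span dimV (normal_free a0 v0 av) (z - m).
exists s, t; split; last by rewrite -zE addrC subrK.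
apply: (H a v a0 v0 av s t); rewrite -zE.
by move: zB; rewrite /bisector /= opprD opprB addrA (addrC a) addrA.
Qed.

(** With v normal to a, the convex function r |-> |t v + r a| is minimal at 0;
    equal values at s - 1 and s + 1, both positive, would contradict its strict
    convexity. *)
Lemma strictly_convex_radon_slabs :
  strictly_convex V -> radon V -> bisectors_in_slabs.
Proof.
move=> sc rad a v a0 v0 av.
have va := (rad a v a0 v0).1 av.
have s_le1 s t : `|s *: a + t *: v - a| = `|s *: a + t *: v + a| -> s <= 1.
  move=> st; rewrite leNgt; apply/negP => s1.
  have sp0 : 0 < s + 1 by lra.
  have [t0|t0] := eqVneq t 0.
    move: st; rewrite t0 scale0r addr0.
    have -> : s *: a - a = (s - 1) *: a by vector_field.
    have -> : s *: a + a = (s + 1) *: a by vector_field.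
    rewrite !normrZ => /(mulIf _); rewrite normr_eq0 => /(_ a0).
    by rewrite !gtr0_norm//; lra.
  (* The point t v + (s - 1) a divides the segment from t v to
     t v + (s + 1) a in the ratio k : 1 - k. *)
  pose k := (s - 1) / (s + 1).
  have k0 : 0 < k by rewrite divr_gt0//; lra.
  have k1 : 0 < 1 - k.
    have -> : 1 - k = 2 / (s + 1) by rewrite /k; field; rewrite gt_eqF.
    by rewrite divr_gt0.
  pose x := (1 - k) *: (t *: v); pose y := k *: (t *: v + (s + 1) *: a).
  have fxy : free [:: x; y].
    rewrite free_cons seq1_free span_seq1; apply/andP; split.
      apply/vlineP => -[r xy].
      have r0 : - (r * k * (s + 1)) = 0.
        apply: (normal_coord0 a0 av (t := (1 - k - r * k) * t)).
        by rewrite -(subrr x) {2}xy /x /y; vector_field.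
      move: r0 => /eqP; rewrite oppr_eq0 (mulf_eq0 (r * k)) (mulf_eq0 r).
      rewrite (gt_eqF k0) (gt_eqF sp0) !orbF => /eqP r0; move/eqP: xy.
      by rewrite r0 scale0r !scaler_eq0 (gt_eqF k1) (negPf t0) (negPf v0).
    apply/eqP => y0; have /eqP : k * (s + 1) = 0.
      apply: (normal_coord0 a0 av (t := k * t)).
      by rewrite -y0 /y; vector_field.
    by rewrite (mulf_eq0 k) !gt_eqF.
  have := sc _ _ fxy.
  have -> : x + y = s *: a + t *: v - a.
    by rewrite /x /y /k; vector_field; rewrite gt_eqF.
  have := normal_scale t va (s - 1).
  have -> : t *: v + (s - 1) *: a = s *: a + t *: v - a by vector_field.
  rewrite /x /y (normrZ (1 - k)) (normrZ k) !gtr0_norm//.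
  have -> : t *: v + (s + 1) *: a = s *: a + t *: v + a by vector_field.
  rewrite -st; nra.
(* The bisector of a and -a is symmetric about the origin. *)
move=> s t st; rewrite ler_norml (s_le1 s t)// andbT.
rewrite lerNl; apply: (s_le1 _ (- t)).
rewrite -normrN -[RHS]normrN.
have -> : - (- s *: a + - t *: v - a) = s *: a + t *: v + a by vector_field.
have -> : - (- s *: a + - t *: v + a) = s *: a + t *: v - a by vector_field.
by [].
Qed.

(** The line through a multiple of v + t a in direction a contains a bisector
    point within one unit of a from that multiple; if t were non-zero, a large
    multiple would put this point outside the slab. *)
Lemma slabs_normal_shift0 {a v t} : bisectors_in_slabs -> a != 0 -> v != 0 ->
  normal a v -> normal (v + t *: a) a -> t = 0.
Proof.
move=> H a0 v0 av va; apply/eqP/negPn/negP => t0.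
(* The a-coordinate of d is 3: moving by at most one unit of a keeps it at
   least 2. *)
pose d := (3 / t) *: (v + t *: a).
have da : normal d a by exact: normal_scale.
pose g (r : R) := `|(d + a) + r *: a| - `|(d - a) + r *: a|.
have g_cont : continuous g.
  by move=> r; apply: cvgB; exact: continuous_norm_line.
have gm1 : g (-1) <= 0.
  rewrite /g !scaleN1r addrK subr_le0.
  by have := da (- 2); congr (_ <= `|_|); vector_field.
have g1 : 0 <= g 1.
  rewrite /g !scale1r subrK subr_ge0.
  by have := da 2; congr (_ <= `|_|); vector_field.
have [|||r] := @IVT R g (-1) 1 0.
- by lra.
- exact: continuous_subspaceT.
- by rewrite ge_min le_max gm1 g1 orbT.
rewrite in_itv /= => /andP[r1 _] /eqP; rewrite subr_eq0 => /eqP gr.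
have : `|3 + r| <= 1.
  apply: (H a v a0 v0 av _ (3 / t)).
  have -> : (3 + r) *: a + (3 / t) *: v - a = (d - a) + r *: a.
    by rewrite /d; vector_field.
  rewrite -gr; congr (`|_|).
  by rewrite /d; vector_field.
by rewrite ler_norml; lra.
Qed.

Lemma slabs_radon : bisectors_in_slabs -> radon V.
Proof.
move=> H.
have sym x y : x != 0 -> y != 0 -> normal x y -> normal y x.
  move=> x0 y0 xy; have [t yx] := normal_left_exists y x0.
  by move: (yx); rewrite (slabs_normal_shift0 H x0 y0 xy yx) scale0r addr0.
by move=> x y x0 y0; split; exact: sym.
Qed.

(** If |p + q| = |p| + |q|, the norm is constant along a segment of direction
    a = |p| q - |q| p that contains both c = p + q and a multiple of p.  Both are
    normal to a, contradicting the uniqueness in slabs_normal_shift0. *)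
Lemma slabs_strictly_convex : bisectors_in_slabs -> strictly_convex V.
Proof.
move=> H p q fpq; rewrite ltNge; apply/negP => le_pq.
have := fpq; rewrite free_cons seq1_free span_seq1 => /andP[pq q0].
have p0 : p != 0 by apply: contraNneq pq => ->; exact: mem0v.
pose P := `|p|; pose Q := `|q|; pose c := p + q; pose a := P *: q - Q *: p.
have P0 : 0 < P by rewrite normr_gt0.
have Q0 : 0 < Q by rewrite normr_gt0.
have cE : `|c| = P + Q by apply/eqP; rewrite eq_le ler_normD.
have a0 : a != 0.
  apply: contraNneq pq => /eqP; rewrite subr_eq0 => /eqP aE.
  apply/vlineP; exists (Q^-1 * P).
  by rewrite -scalerA aE scalerA mulVf ?scale1r// gt_eqF.
have ca : normal c a.
  (* For t >= 0, (1 + t |p|) c is c + t a plus a multiple of p, and for t <= 0,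
     (1 - t |q|) c is c + t a plus a multiple of q; the triangle inequality
     then bounds |c + t a| from below by |c|. *)
  move=> t; rewrite cE; have [t0|/ltW t0] := leP 0 t.
    have := ler_normB (c + t *: a) (- ((t * (P + Q)) *: p)).
    rewrite normrN normrZ -/P ger0_norm; last by rewrite mulr_ge0 ?addr_ge0// ltW.
    have -> : c + t *: a - - ((t * (P + Q)) *: p) = (1 + t * P) *: c.
      by rewrite /c /a; vector_field.
    rewrite normrZ cE ger0_norm; last by rewrite addr_ge0// mulr_ge0// ltW.
    nra.
  have := ler_normB (c + t *: a) ((t * (P + Q)) *: q).
  rewrite normrZ -/Q ler0_norm; last by rewrite mulr_le0_ge0 ?addr_ge0// ltW.
  have -> : c + t *: a - (t * (P + Q)) *: q = (1 - t * Q) *: c.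
    by rewrite /c /a; vector_field.
  rewrite normrZ cE ger0_norm; last first.
    by rewrite subr_ge0 (le_trans _ ler01)// mulr_le0_ge0// ltW.
  nra.
(* c - a / |p| is the multiple of p that has the norm of c. *)
have c'a : normal (c + - P^-1 *: a) a.
  apply: normal_shift => //.
  have -> : c + - P^-1 *: a = ((P + Q) / P) *: p.
    by rewrite /c /a; vector_field; exact: lt0r_neq0.
  rewrite normrZ cE gtr0_norm ?divr_gt0 ?addr_gt0// -/P divfK//.
  exact: lt0r_neq0.
have [v v0 av] := normal_right_exists dimV a0.
have [s [t ct]] := free2_span dimV (normal_free a0 v0 av) c.
have c0 : c != 0 by rewrite -normr_eq0 cE gt_eqF ?addr_gt0.
have t0 : t != 0.
  apply/eqP => t0; have := ca (- s).
  by rewrite scaleNr {2}ct t0 scale0r addr0 subrr normr0 normr_le0 (negPf c0).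
have := normal_scale t^-1 ca; have := normal_scale t^-1 c'a.
have -> : t^-1 *: c = v + (s / t) *: a by rewrite ct; vector_field.
have -> : t^-1 *: (c + - P^-1 *: a) = v + ((s - P^-1) / t) *: a.
  by rewrite ct; vector_field; rewrite t0 gt_eqF.
move=> /(slabs_normal_shift0 H a0 v0 av)/eqP.
rewrite mulf_eq0 invr_eq0 (negPf t0) orbF subr_eq0 => /eqP sP.
move=> /(slabs_normal_shift0 H a0 v0 av)/eqP.
by rewrite sP mulf_eq0 !invr_eq0 (negPf t0) orbF gt_eqF.
Qed.

End MainArgument.

Theorem corollary7 (R : realType) (V : normedVectType R)
    (dimV : \dim {: V} = 2%N) :
  (strictly_convex V /\ radon V) <->
  (forall (x y : V), x != y ->
   forall (lx ly : set V), parallel lx ly ->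
     supports lx (midpoint x y) (half_dist x y) x ->
     supports ly (midpoint x y) (half_dist x y) y ->
     bisector x y `<=` strip lx ly).
Proof.
apply: iff_trans (iff_sym (bisector_in_strip_iff dimV)).
split=> [[sc rad]|H]; first exact: strictly_convex_radon_slabs.
by split; [exact: slabs_strictly_convex|exact: slabs_radon].
Qed.
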